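(* Let $\mathcal{C}$ be a family of graphs with degree bound $d$. If there exists an $(\epsilon,k)$-partition oracle $\mathcal{O}$ with respect to $\mathcal{C}$ having query complexity $q(\epsilon,k,d,n)$ and running time $t(\epsilon,k,d,n)$, then there exists a local sparse spanning graph algorithm $\mathcal{A}$ with respect to $\mathcal{C}$ whose success probability is the same as that of $\mathcal{O}$, whose running time is at most $t(\epsilon,k,d,n)+O(kd)$, and whose query complexity is $q(\epsilon,k,d,n)+O(kd)$.
   Context: Graphs $G=(V,E)$ have $n=|V|$ vertices, degree bound $d$, distinct vertex ids, and are accessed via incidence-list queries (the $i$-th neighbor of $v$). A local sparse spanning graph algorithm with respect to a class $\mathcal{C}$, given query access to a connected graph $G\in\mathcal{C}$, answers for each queried edge $(u,v)\in E$ whether $(u,v)\in E'$, where $E'$ is determined by $G$ and the algorithm's internal randomness, such that $G'=(V,E')$ is connected with probability $1$ and $|E'|\le(1+\epsilon)n$ with the stated (success) probability. For a partition $\mathcal{P}$ of $V$, $g_{\mathcal{P}}(v)$ denotes the part containing $v$. A partition oracle $\mathcal{O}$, given query access to $G$, provides query access to a partition $\mathcal{P}=(V_1,\dots,V_t)$ of $V$ determined by $G$ and the oracle's internal randomness: on input $v$ it returns $g_{\mathcal{P}}(v)$, consistently with the same $\mathcal{P}$ for any sequence of queries. $\mathcal{O}$ is an $(\epsilon,k)$-partition oracle with respect to $\mathcal{C}$ if (1) every part $V_\ell$ has $|V_\ell|\le k$ and induces a connected subgraph of $G$, and (2) if $G\in\mathcal{C}$ then $|\{(u,v)\in E: g_{\mathcal{P}}(u)\ne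 g_{\mathcal{P}}(v)\}|\le\epsilon|V|$ with high constant probability over the oracle's coins (its success probability). *)

(* Defs.v *)
From HB Require Import structures.
From mathcomp Require Import all_boot all_order all_algebra.
From mathcomp Require Import classical_sets reals ereal measure probability.

Set Implicit Arguments.
Unset Strict Implicit.
Unset Printing Implicit Defensive.

Import Order.TTheory GRing.Theory Num.Theory.

Record graph := Graph {
  vertex :> finType;
  adj : rel vertex;
  adj_sym : symmetric adj;
  adj_irr : irreflexive adj }.

Arguments adj {g}.

Definition degree_le (d : nat) (G : graph) : Prop :=
  forall v : G, #|[pred w | adj v w]| <= d.

Definition edges (G : graph) : {set {set G}} :=
  [set [set uv.1; uv.2] | uv : G * G & adj uv.1 uv.2]%SET.

Definition connected_edges (G : graph) (E' : {set {set G}}) : Prop :=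
  forall u v : G, connect [rel x y | [set x; y]%SET \in E'] u v.

Definition connected_graph (G : graph) : Prop :=
  forall u v : G, connect adj u v.

Definition induces_connected (G : graph) (S : {set G}) : Prop :=
  {in S &, forall u v,
     connect [rel x y | [&& x \in S, y \in S & adj x y]] u v}.

(* [finset.pblock P v] is g_P(v), the part of [P] containing [v]. *)
Definition cut_edges (G : graph) (P : {set {set G}}) : {set {set G}} :=
  [set [set uv.1; uv.2] | uv : G * G
     & adj uv.1 uv.2 && (finset.pblock P uv.1 != finset.pblock P uv.2)]%SET.

(** What an algorithm sees of a graph: vertex ids and incidence lists. A family
    of graphs is a predicate on [graph], hence independent of both. *)
Record access (G : graph) := Access {
  vid : G -> nat;
  vid_inj : injective vid;
  inc : G -> seq G;
  inc_uniq : forall v, uniq (inc v);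
  mem_inc : forall v w, (w \in inc v) = adj v w }.

(* The answer to "the i-th neighbor (from 0) of the vertex with id a": 0 if
   there is none, and otherwise 1 plus the id of that neighbor. *)
Definition neighbor (G : graph) (ac : access G) (a i : nat) : nat :=
  if [pick v | vid ac v == a] is Some v then
    if i < size (inc ac v) then (vid ac (nth v (inc ac v) i)).+1 else 0
  else 0.

(** A unit-cost random access machine with the operations of Cook and Reckhow
    (constants, addition, subtraction, indirect load and store, test against
    0), presented as while-programs over natural-number registers and arrays,
    and extended with two instructions: reading a cell of the random tape and
    an incidence-list query. *)

Record store := Store { reg : nat -> nat; arr : nat -> nat -> nat }.

Definition store0 : store := Store (fun=> 0) (fun _ _ => 0).

Definition set_reg (x a : nat) (s : store) : store :=
  Store (fun y => if y == x then a else reg s y) (arr s).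

Definition set_arr (A i a : nat) (s : store) : store :=
  Store (reg s) (fun B j => if (B == A) && (j == i) then a else arr s B j).

Definition load (xs : seq nat) (s : store) : store :=
  Store (fun x => if x < size xs then nth 0 xs x else reg s x) (arr s).

Inductive prog : Type :=
| Skip
| Const of nat & nat
| Add of nat & nat & nat
| Sub of nat & nat & nat
| Get of nat & nat & nat
| Put of nat & nat & nat
| Coin of nat & nat
| Nbr of nat & nat & nat
| Seq of prog & prog
| If of nat & prog & prog
| While of nat & prog.

(* [exec nbr tape c s s' q t]: from [s], program [c] halts in [s'] after [q]
   incidence-list queries and [t] steps. The random tape is read-only and
   random-access, so that all invocations share the same randomness. *)
Inductive exec (nbr : nat -> nat -> nat) (tape : nat -> bool) :
    prog -> store -> store -> nat -> nat -> Prop :=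
| ESkip s : exec nbr tape Skip s s 0 1
| EConst x a s : exec nbr tape (Const x a) s (set_reg x a s) 0 1
| EAdd x y z s :
    exec nbr tape (Add x y z) s (set_reg x (reg s y + reg s z) s) 0 1
| ESub x y z s :
    exec nbr tape (Sub x y z) s (set_reg x (reg s y - reg s z) s) 0 1
| EGet x A y s :
    exec nbr tape (Get x A y) s (set_reg x (arr s A (reg s y)) s) 0 1
| EPut A x y s :
    exec nbr tape (Put A x y) s (set_arr A (reg s x) (reg s y) s) 0 1
| ECoin x y s :
    exec nbr tape (Coin x y) s (set_reg x (nat_of_bool (tape (reg s y))) s) 0 1
| ENbr x y z s :
    exec nbr tape (Nbr x y z) s (set_reg x (nbr (reg s y) (reg s z)) s) 1 1
| ESeq c1 c2 s s1 s2 q1 q2 t1 t2 :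
    exec nbr tape c1 s s1 q1 t1 -> exec nbr tape c2 s1 s2 q2 t2 ->
    exec nbr tape (Seq c1 c2) s s2 (q1 + q2) (t1 + t2)
| EIfT x c1 c2 s s1 q t :
    reg s x != 0 -> exec nbr tape c1 s s1 q t ->
    exec nbr tape (If x c1 c2) s s1 q t.+1
| EIfF x c1 c2 s s1 q t :
    reg s x = 0 -> exec nbr tape c2 s s1 q t ->
    exec nbr tape (If x c1 c2) s s1 q t.+1
| EWhileT x c s s1 s2 q1 q2 t1 t2 :
    reg s x != 0 -> exec nbr tape c s s1 q1 t1 ->
    exec nbr tape (While x c) s1 s2 q2 t2 ->
    exec nbr tape (While x c) s s2 (q1 + q2) (t1 + t2).+1
| EWhileF x c s : reg s x = 0 -> exec nbr tape (While x c) s s 0 1.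

(** An algorithm is a program that is invoked once per query. The input is put
    in the first registers and memory persists between invocations:
    [reachable] are the memories after an arbitrary finite sequence of legal
    queries, starting from a zeroed memory. *)
Inductive reachable (nbr : nat -> nat -> nat) (tape : nat -> bool)
    (legal : seq nat -> Prop) (c : prog) : store -> Prop :=
| ReachInit : reachable nbr tape legal c store0
| ReachStep s s' xs q t :
    reachable nbr tape legal c s -> legal xs ->
    exec nbr tape c (load xs s) s' q t -> reachable nbr tape legal c s'.

(* An input always starts with the number of vertices. *)
Definition vertex_query (G : graph) (ac : access G) (xs : seq nat) : Prop :=
  exists v : G, xs = [:: #|G|; vid ac v].

Definition edge_query (G : graph) (ac : access G) (xs : seq nat) : Prop :=
  exists u v : G, adj u v /\ xs = [:: #|G|; vid ac u; vid ac v].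

(* Worst case over the members of [C] (with any ids and incidence lists), the
   random tape, the history of queries and the query; [q] and [t] are functions
   of the number of vertices. *)
Definition complexity_le (C : graph -> Prop)
    (legal : forall G : graph, access G -> seq nat -> Prop)
    (c : prog) (q t : nat -> nat) : Prop :=
  forall (G : graph) (ac : access G) (tape : nat -> bool) s xs,
    C G -> reachable (neighbor ac) tape (legal G ac) c s -> legal G ac xs ->
    exists s' q' t', [/\ exec (neighbor ac) tape c (load xs s) s' q' t',
                         q' <= q #|G| & t' <= t #|G|].

(* A list of ids without repetition: its length is in register 0, its entries
   are in the first cells of array 0. *)
Definition output_list (s : store) : seq nat :=
  [seq arr s 0 i | i <- iota 0 (reg s 0)].

Definition output_bool (s : store) : bool := reg s 0 != 0.

Local Open Scope ring_scope.
Local Open Scope classical_set_scope.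

Definition fair_coins (R : realType) (disp : measure_display)
    (Omega : measurableType disp) (Pr : probability Omega R)
    (coin : Omega -> nat -> bool) : Prop :=
  (forall i, measurable [set w | coin w i]) /\
  (forall b : seq bool,
     Pr [set w | forall i, (i < size b)%N -> coin w i = nth false b i]
     = ((2^-1) ^+ size b)%:E).

Section Algorithms.
Variables (R : realType) (disp : measure_display).
Variables (Omega : measurableType disp) (Pr : probability Omega R).
Variable coin : Omega -> nat -> bool.

(* [p] is the guaranteed success probability. Only the bound on the number of
   cut edges is restricted to members of [C]. *)
Definition partition_oracle (C : graph -> Prop) (d : nat) (eps : R) (k : nat)
    (p : R) (O : prog) : Prop :=
  forall (G : graph) (ac : access G), degree_le d G ->
  exists P : (nat -> bool) -> {set {set G}},
    [/\ forall tape, finset.partition (P tape) [set: G]%SET,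
        forall tape s (v : G),
          reachable (neighbor ac) tape (vertex_query ac) O s ->
          exists s' q t,
            exec (neighbor ac) tape O (load [:: #|G|; vid ac v] s) s' q t /\
            perm_eq (output_list s')
                    [seq vid ac w | w <- enum (finset.pblock (P tape) v)],
        forall tape (S : {set G}), S \in P tape ->
          (#|S| <= k)%N /\ induces_connected S
      & C G ->
        (p%:E <= Pr [set w | (#|cut_edges (P (coin w))|%:R
                               <= eps * #|G|%:R :> R)%R])%E].

Definition sparse_spanning_algorithm (C : graph -> Prop) (eps p : R)
    (A : prog) : Prop :=
  forall (G : graph) (ac : access G), C G -> connected_graph G ->
  exists E' : (nat -> bool) -> {set {set G}},
    [/\ forall tape, E' tape \subset edges G,
        forall tape s (u v : G),
          reachable (neighbor ac) tape (edge_query ac) A s -> adj u v ->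
          exists s' q t,
            exec (neighbor ac) tape A
                 (load [:: #|G|; vid ac u; vid ac v] s) s' q t /\
            output_bool s' = ([set u; v]%SET \in E' tape),
        Pr [set w | connected_edges (E' (coin w))] = 1%E
      & (p%:E <= Pr [set w | (#|E' (coin w)|%:R
                               <= (1 + eps) * #|G|%:R :> R)%R])%E].

End Algorithms.

(* Main.v *)
Require Import Defs.
From HB Require Import structures.
From mathcomp Require Import all_boot all_order all_algebra.
From mathcomp Require Import classical_sets reals ereal measure probability.
From mathcomp Require Import boolp zify.

Set Implicit Arguments.
Unset Strict Implicit.
Unset Printing Implicit Defensive.

Import Order.TTheory GRing.Theory Num.Theory.

(** On a query [(u, v)], ask the oracle for the part [S] of [u]. If [v] is not in
    [S], keep the edge; otherwise keep it iff it belongs to the breadth-first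
    tree of [S] rooted at its vertex of least id, a tree that depends only on
    [S] and the incidence lists, so that answers do not depend on the history.
    The kept edges are the cut edges and one parent edge per vertex at most,
    whence [|E'| <= |cut| + n], and they connect each (connected) part, whence
    they connect [G].

    Unit-cost arrays indexed by ids make the search linear in [k * d]: a vertex
    is in the part and not yet reached iff its mark equals the number of the
    current invocation, so marks are never erased. The oracle runs on its own
    registers and arrays, shifted past those of the search.

    A halting run reads a finite prefix of the tape, so the partition is a
    measurable function of the coins, which is needed to compare the
    probabilities of the two size bounds. *)

(** * Breadth-first search inside a vertex set *)

Section Traversal.
Variables (G : graph) (ac : access G) (S : {set G}).
Implicit Types (r x y : G) (vis : seq (G * G)).

(* The pairs in [vis] are (reached vertex, its parent), in queue order. *)
Definition visit x vis y :=
  if (y \in S) && (y \notin unzip1 vis) then rcons vis (y, x) else vis.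

(* After [h] vertices have been dequeued. The root is its own parent. *)
Fixpoint traverse r h : seq (G * G) :=
  if h is h'.+1 then
    let x := (nth (r, r) (traverse r h') h').1 in
    foldl (visit x) (traverse r h') (inc ac x)
  else [:: (r, r)].

(** The loop invariant of the search. Pairs go from child to parent, so the connecting relation
    reads them backwards; the case [p.1 = p.2] accommodates the root, which is its own parent. *)
Definition search_tree r vis : Prop :=
  [/\ uniq (unzip1 vis), {subset unzip1 vis <= S}, r \in unzip1 vis,
      {in unzip1 vis, forall y, connect [rel a b | (b, a) \in vis] r y}
    & {in vis, forall p, p.1 = p.2 \/ adj p.1 p.2}].

Lemma prefix_visit x vis y : prefix vis (visit x vis y).
Proof.
by rewrite /visit; case: ifP => _; rewrite ?prefix_refl // -cats1 prefix_prefix.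
Qed.

Lemma prefix_foldl_visit x vis ys : prefix vis (foldl (visit x) vis ys).
Proof.
elim: ys vis => [|y ys IH] vis /=; first exact: prefix_refl.
exact: prefix_trans (prefix_visit x vis y) (IH _).
Qed.

Lemma prefix_unzip1 vis1 vis2 :
  prefix vis1 vis2 -> {subset unzip1 vis1 <= unzip1 vis2}.
Proof. by case/prefixP=> t -> y; rewrite /unzip1 map_cat mem_cat => ->. Qed.

Lemma nth_prefix (T : eqType) (a : T) s1 s2 i :
  prefix s1 s2 -> i < size s1 -> nth a s2 i = nth a s1 i.
Proof. by case/prefixP=> t -> lt_i; rewrite nth_cat lt_i. Qed.

Lemma size_prefix (T : eqType) (s1 s2 : seq T) :
  prefix s1 s2 -> size s1 <= size s2.
Proof. by case/prefixP=> t ->; rewrite size_cat leq_addr. Qed.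

Lemma search_tree_visit r x vis y :
  search_tree r vis -> x \in unzip1 vis -> adj x y ->
  search_tree r (visit x vis y).
Proof.
rewrite /visit; case: ifP => // /andP[yS y_new] [uvis sub rvis conn adjP] xvis xy.
have unz : unzip1 (rcons vis (y, x)) = rcons (unzip1 vis) y by exact: map_rcons.
have mono z : z \in unzip1 vis ->
    connect [rel a b | (b, a) \in rcons vis (y, x)] r z.
  move=> /conn; apply: connect_sub => a b /= ab; apply: connect1.
  by rewrite /= mem_rcons inE ab orbT.
rewrite /search_tree unz; split.
- by rewrite rcons_uniq y_new.
- by move=> z; rewrite mem_rcons inE => /predU1P[->|/sub].
- by rewrite mem_rcons inE rvis orbT.
- move=> z; rewrite mem_rcons inE => /predU1P[->|/mono //].
  by apply: connect_trans (mono _ xvis) (connect1 _); rewrite /= mem_rcons mem_head.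
- move=> p; rewrite mem_rcons inE => /predU1P[->|/adjP //].
  by right; rewrite adj_sym.
Qed.

Lemma search_tree_foldl r x vis ys :
  search_tree r vis -> x \in unzip1 vis -> {in ys, forall y, adj x y} ->
  search_tree r (foldl (visit x) vis ys).
Proof.
elim: ys vis => //= y ys IH vis tree xvis xys; apply: IH.
- by apply: search_tree_visit => //; apply: xys; rewrite mem_head.
- exact: prefix_unzip1 (prefix_visit x vis y) _ xvis.
- by move=> z zs; apply: xys; rewrite inE zs orbT.
Qed.

Lemma foldl_visit_closed x vis ys y :
  y \in ys -> y \in S -> y \in unzip1 (foldl (visit x) vis ys).
Proof.
elim: ys vis => //= z ys IH vis; rewrite inE => /predU1P[<-|ys_y] yS; last exact: IH.
apply: prefix_unzip1 (prefix_foldl_visit _ _ _) _ _.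
rewrite /visit yS /=; case: ifPn => [_|/negPn //].
by rewrite /unzip1 map_rcons mem_rcons mem_head.
Qed.

Variable r : G.
Hypothesis rS : r \in S.

Lemma nth_traverse_visited vis h :
  r \in unzip1 vis -> (nth (r, r) vis h).1 \in unzip1 vis.
Proof.
move=> rvis; case: (ltnP h (size vis)) => [lt_h|le_h]; last by rewrite nth_default.
by rewrite map_f // mem_nth.
Qed.

Lemma search_tree_traverse h : search_tree r (traverse r h).
Proof.
elim: h => [|h IH] /=.
  split=> //= [x||y|p]; rewrite ?mem_head // inE => /eqP-> //; by left.
apply: search_tree_foldl => //; last by move=> y; rewrite mem_inc.
by apply: nth_traverse_visited; case: IH.
Qed.

Lemma size_traverse_le h : size (traverse r h) <= #|S|.
Proof.
have [uvis sub _ _ _] := search_tree_traverse h.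
rewrite -(size_map fst) cardE; apply: uniq_leq_size => // y /sub.
by rewrite mem_enum.
Qed.

Lemma prefix_traverse h1 h2 :
  h1 <= h2 -> prefix (traverse r h1) (traverse r h2).
Proof.
move=> /subnK <-; elim: (h2 - h1) => [|n IH]; first exact: prefix_refl.
exact: prefix_trans IH (prefix_foldl_visit _ _ _).
Qed.

(** Queue position [i] is dequeued in round [i], and later rounds only append. The bound on [i]
    ensures that this round scans a genuine entry and not the default [r]. *)
Lemma traverse_closed h i y :
  i < h -> i < size (traverse r i) -> y \in S ->
  adj (nth (r, r) (traverse r h) i).1 y -> y \in unzip1 (traverse r h).
Proof.
move=> lt_ih lt_i yS; rewrite (nth_prefix _ (prefix_traverse (ltnW lt_ih)) lt_i).
move=> xy; apply: prefix_unzip1 (prefix_traverse lt_ih) _ _ => /=.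
by apply: foldl_visit_closed => //; rewrite mem_inc.
Qed.

Hypothesis S_connected : induces_connected S.

(** If the queue ran empty at round [h], every reached vertex would have been scanned, so the
    reached set would be closed under adjacency in [S]. By connectivity it would contain [S], which
    has more than [h] elements. *)
Lemma traverse_progress h : h < #|S| -> h < size (traverse r h).
Proof.
elim/ltn_ind: h => h IH lt_hS; rewrite ltnNge; apply/negP => le_h.
have [uvis sub rvis _ _] := search_tree_traverse h.
(* Strong induction: each earlier round dequeued a genuine entry. *)
have size_i i : i < h -> i < size (traverse r i).
  by move=> lt_ih; apply: IH => //; apply: ltn_trans lt_hS.
suff SV : {subset enum S <= unzip1 (traverse r h)}.
  have := uniq_leq_size (enum_uniq S) SV.
  rewrite -cardE size_map; lia.
move=> y; rewrite mem_enum => yS.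
have closedV : fingraph.closed [rel a b | [&& a \in S, b \in S & adj a b]]
    [pred z | z \in unzip1 (traverse r h)].
  apply: intro_closed => [|a b /=].
    by apply: sym_connect_sym => a b; rewrite /= adj_sym andbCA.
  case/and3P=> aS bS ab /mapP[p p_vis a_p].
  have lt_p : index p (traverse r h) < size (traverse r h) by rewrite index_mem.
  have lt_ph := leq_trans lt_p le_h.
  apply: traverse_closed lt_ph (size_i _ lt_ph) bS _.
  by rewrite nth_index // -a_p.
have := closed_connect closedV (S_connected rS yS).
by rewrite !inE rvis.
Qed.

Lemma size_traverse : size (traverse r #|S|) = #|S|.
Proof.
apply/eqP; rewrite eqn_leq size_traverse_le /=.
have: 0 < #|S| by apply/card_gt0P; exists r.
(* Progress at round [#|S| - 1] already yields [#|S|] entries, and the last round removes none. *)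
case: #|S| traverse_progress => // n progress _.
apply: leq_trans (progress n (ltnSn n)) _.
exact: size_prefix (prefix_traverse (leqnSn n)).
Qed.

Lemma mem_traverse : unzip1 (traverse r #|S|) =i S.
Proof.
have [uvis sub _ _ _] := search_tree_traverse #|S|.
have sub' : {subset unzip1 (traverse r #|S|) <= enum S}.
  by move=> z /sub; rewrite mem_enum.
have [|_ eq_vis] := uniq_min_size uvis sub'.
  by rewrite -cardE size_map size_traverse.
by move=> y; rewrite eq_vis mem_enum.
Qed.

End Traversal.

(** * Determinism of executions and their finite use of the tape *)

Lemma exec_det nbr tape c s s1 q1 t1 s2 q2 t2 :
  exec nbr tape c s s1 q1 t1 -> exec nbr tape c s s2 q2 t2 ->
  [/\ s1 = s2, q1 = q2 & t1 = t2].
Proof.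
move=> e1; elim: e1 s2 q2 t2 => {c s s1 q1 t1}
  [s|x a s|x y z s|x y z s|x A y s|A x y s|x y s|x y z s
  |c1 c2 s sa sb qa qb ta tb _ IH1 _ IH2
  |x c1 c2 s sa qa ta nz _ IH|x c1 c2 s sa qa ta z _ IH
  |x c s sa sb qa qb ta tb nz _ IH1 _ IH2|x c s z] s' q' t' e2;
  inversion e2; subst=> //.
all: try by match goal with H : is_true (?r != 0), H' : ?r = 0 |- _ =>
  rewrite H' in H end.
all: repeat match goal with
  IH : forall s2 q2 t2, exec _ _ ?c ?s _ _ _ -> _, H : exec _ _ ?c ?s _ _ _ |- _ =>
    case: (IH _ _ _ H) => ???; subst; clear H
  end; by [].
Qed.

(** A halting derivation is finite and only [Coin] looks at the tape, one cell at a time, so the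
    cells read are bounded. *)
Lemma exec_tape_prefix nbr tape c s s' q t :
  exec nbr tape c s s' q t ->
  exists N, forall tape', (forall i, i < N -> tape i = tape' i) ->
    exec nbr tape' c s s' q t.
Proof.
elim=> {c s s' q t}
  [s|x a s|x y z s|x y z s|x A y s|A x y s|x y s|x y z s
  |c1 c2 s sa sb qa qb ta tb _ [N1 IH1] _ [N2 IH2]
  |x c1 c2 s sa qa ta nz _ [N IH]|x c1 c2 s sa qa ta z _ [N IH]
  |x c s sa sb qa qb ta tb nz _ [N1 IH1] _ [N2 IH2]|x c s z];
  try by exists 0 => tape' _; constructor.
- by exists (reg s y).+1 => tape' eq_t; rewrite eq_t //; constructor.
- exists (maxn N1 N2) => tape' eq_t; econstructor; [apply: IH1|apply: IH2];
    by move=> i lt_i; apply: eq_t; rewrite leq_max lt_i ?orbT.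
- by exists N => tape' /IH ?; constructor.
- by exists N => tape' /IH ?; apply: EIfF.
- exists (maxn N1 N2) => tape' eq_t; econstructor=> //; [apply: IH1|apply: IH2];
    by move=> i lt_i; apply: eq_t; rewrite leq_max lt_i ?orbT.
Qed.

(** * Total-correctness triples with bounds on queries and steps *)

Definition runs nbr tape c s q t (Q : store -> Prop) : Prop :=
  exists s' q' t', [/\ exec nbr tape c s s' q' t', q' <= q, t' <= t & Q s'].

Section Runs.
Variables (nbr : nat -> nat -> nat) (tape : nat -> bool).
Notation runs := (runs nbr tape).

Lemma runs_weaken c s q t q' t' (Q Q' : store -> Prop) :
  q <= q' -> t <= t' -> (forall s', Q s' -> Q' s') ->
  runs c s q t Q -> runs c s q' t' Q'.
Proof.
move=> le_q le_t QQ' [s1 [q1 [t1 [e1 le_q1 le_t1 /QQ' Q1]]]].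
by exists s1, q1, t1; split=> //; [apply: leq_trans le_q|apply: leq_trans le_t].
Qed.

Lemma runs_seq c1 c2 s q1 t1 q2 t2 (Q : store -> Prop) :
  runs c1 s q1 t1 (fun s1 => runs c2 s1 q2 t2 Q) ->
  runs (Seq c1 c2) s (q1 + q2) (t1 + t2) Q.
Proof.
move=> [sa [qa [ta [ea le_qa le_ta [sb [qb [tb [eb le_qb le_tb Qb]]]]]]]].
exists sb, (qa + qb), (ta + tb); split; rewrite ?leq_add //; exact: ESeq ea eb.
Qed.

Lemma runs_if x c1 c2 s q t (Q : store -> Prop) :
  runs (if reg s x == 0 then c2 else c1) s q t Q ->
  runs (If x c1 c2) s q t.+1 Q.
Proof.
move=> [s1 [q1 [t1 [e1 le_q1 le_t1 Q1]]]]; exists s1, q1, t1.+1; split=> //.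
by case: eqP e1 => [z|/eqP nz] e1; [apply: EIfF|apply: EIfT].
Qed.

(** The invariant is indexed by the number of completed rounds, and the loop makes exactly [m] of
    them. Each round pays one step for its test; the outer successor pays for the final failing
    test. *)
Lemma runs_while x c m (I : nat -> store -> Prop) q t s :
  (forall i s1, i < m -> I i s1 -> reg s1 x != 0 /\ runs c s1 q t (I i.+1)) ->
  (forall s1, I m s1 -> reg s1 x = 0) -> I 0 s ->
  runs (While x c) s (m * q) (m * t.+1).+1 (I m).
Proof.
move=> body stop I0; suff H n i s1 : n + i = m -> I i s1 ->
    runs (While x c) s1 (n * q) (n * t.+1).+1 (I m).
  by apply: (H m 0) => //; rewrite addn0.
elim: n i s1 => [|n IH] i s1 def_m Ii.
  exists s1, 0, 1; rewrite add0n in def_m; subst i; split=> //.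
  by apply: EWhileF; apply: stop.
have lt_im : i < m by lia.
have [nz [sa [qa [ta [ea le_qa le_ta Ia]]]]] := body i s1 lt_im Ii.
have [|sb [qb [tb [eb le_qb le_tb Ib]]]] := IH i.+1 sa _ Ia; first lia.
exists sb, (qa + qb), (ta + tb).+1; split=> //; first exact: EWhileT ea eb.
  by rewrite mulSn leq_add.
by lia.
Qed.

Fixpoint loop_free (c : prog) : bool :=
  match c with
  | Seq c1 c2 | If _ c1 c2 => loop_free c1 && loop_free c2
  | While _ _ => false
  | _ => true
  end.

Fixpoint prog_size (c : prog) : nat :=
  match c with
  | Seq c1 c2 => prog_size c1 + prog_size c2
  | If _ c1 c2 => (prog_size c1 + prog_size c2).+1
  | While _ c1 => (prog_size c1).+1
  | _ => 1
  end.

(* Meaningful on loop-free programs only: loops are skipped. *)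
Fixpoint result (c : prog) (s : store) : store :=
  match c with
  | Skip => s
  | Const x a => set_reg x a s
  | Add x y z => set_reg x (reg s y + reg s z) s
  | Defs.Sub x y z => set_reg x (reg s y - reg s z) s
  | Get x A y => set_reg x (arr s A (reg s y)) s
  | Put A x y => set_arr A (reg s x) (reg s y) s
  | Coin x y => set_reg x (nat_of_bool (tape (reg s y))) s
  | Nbr x y z => set_reg x (nbr (reg s y) (reg s z)) s
  | Seq c1 c2 => result c2 (result c1 s)
  | If x c1 c2 => if reg s x == 0 then result c2 s else result c1 s
  | While _ _ => s
  end.

(** Reduces straight-line code to a computation with [result]. The size bounds queries as well as
    steps, and charges both branches of an [If]. *)
Lemma runs_loop_free c s (Q : store -> Prop) :
  loop_free c -> Q (result c s) -> runs c s (prog_size c) (prog_size c) Q.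
Proof.
elim: c s Q => /=
  [|x a|x y z|x y z|x A y|A x y|x y|x y z|c1 IH1 c2 IH2|x c1 IH1 c2 IH2|//] s Q;
  try by move=> _ Qs; do 3 eexists; split; [econstructor| | |exact: Qs].
- by case/andP=> l1 l2 Qs; apply: runs_seq; apply: IH1 => //; apply: IH2.
- case/andP=> l1 l2 Qs.
  apply: (@runs_weaken _ _ (prog_size c1 + prog_size c2)
    (prog_size c1 + prog_size c2).+1 _ _ Q) => //.
  apply: runs_if; case: eqP Qs => _ Qs.
    by apply: runs_weaken (IH2 _ _ l2 Qs) => //; apply: leq_addl.
  by apply: runs_weaken (IH1 _ _ l1 Qs) => //; apply: leq_addr.
Qed.

End Runs.

(** * Running a program on shifted memory *)

Section Relocation.
Variables (dr da : nat).

Fixpoint relocate (c : prog) : prog :=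
  match c with
  | Skip => Skip
  | Const x a => Const (dr + x) a
  | Add x y z => Add (dr + x) (dr + y) (dr + z)
  | Defs.Sub x y z => Defs.Sub (dr + x) (dr + y) (dr + z)
  | Get x A y => Get (dr + x) (da + A) (dr + y)
  | Put A x y => Put (da + A) (dr + x) (dr + y)
  | Coin x y => Coin (dr + x) (dr + y)
  | Nbr x y z => Nbr (dr + x) (dr + y) (dr + z)
  | Seq c1 c2 => Seq (relocate c1) (relocate c2)
  | If x c1 c2 => If (dr + x) (relocate c1) (relocate c2)
  | While x c1 => While (dr + x) (relocate c1)
  end.

Definition relocated (s S : store) : Prop :=
  (forall x, reg S (dr + x) = reg s x) /\
  (forall A i, arr S (da + A) i = arr s A i).

Definition same_low (S S' : store) : Prop :=
  (forall x, x < dr -> reg S' x = reg S x) /\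
  (forall A i, A < da -> arr S' A i = arr S A i).

Definition same_high (S S' : store) : Prop :=
  (forall x, reg S' (dr + x) = reg S (dr + x)) /\
  (forall A i, arr S' (da + A) i = arr S (da + A) i).

Lemma relocated_high s S S' : relocated s S -> same_high S S' -> relocated s S'.
Proof. by move=> [r1 r2] [h1 h2]; split=> *; rewrite ?h1 ?h2. Qed.

Lemma same_low_trans S1 S2 S3 : same_low S1 S2 -> same_low S2 S3 -> same_low S1 S3.
Proof. by move=> [a1 a2] [b1 b2]; split=> *; rewrite ?b1 ?b2 ?a1 ?a2. Qed.

Lemma relocate_set_reg nbr tape c x a a' s S q t :
  exec nbr tape c S (set_reg (dr + x) a S) q t -> a = a' -> relocated s S ->
  exists S', [/\ exec nbr tape c S S' q t,
                 relocated (set_reg x a' s) S' & same_low S S'].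
Proof.
move=> e <- [r1 r2]; exists (set_reg (dr + x) a S); split=> //; split=> //= y.
  by rewrite eqn_add2l r1.
by move=> lt_y; case: eqP => // def_y; lia.
Qed.

Lemma relocate_set_arr nbr tape c A i i' a a' s S q t :
  exec nbr tape c S (set_arr (da + A) i a S) q t -> i = i' -> a = a' ->
  relocated s S ->
  exists S', [/\ exec nbr tape c S S' q t,
                 relocated (set_arr A i' a' s) S' & same_low S S'].
Proof.
move=> e <- <- [r1 r2]; exists (set_arr (da + A) i a S); split=> //; split=> //= B j.
  by rewrite eqn_add2l r2.
by move=> lt_B; case: eqP => // def_B; lia.
Qed.

(** A simulation instruction by instruction, with the same counts: the embedded oracle costs exactly
    what it costs alone, and the memory below the shift survives the call. *)
Lemma exec_relocate nbr tape c s s' q t S :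
  exec nbr tape c s s' q t -> relocated s S ->
  exists S', [/\ exec nbr tape (relocate c) S S' q t,
                 relocated s' S' & same_low S S'].
Proof.
move=> e; elim: e S => {c s s' q t}
  [s|x a s|x y z s|x y z s|x A y s|A x y s|x y s|x y z s
  |c1 c2 s sa sb qa qb ta tb _ IH1 _ IH2
  |x c1 c2 s sa qa ta nz _ IH|x c1 c2 s sa qa ta z _ IH
  |x c s sa sb qa qb ta tb nz _ IH1 _ IH2|x c s z] S rel; have [r1 r2] := rel; rewrite /=.
- by exists S; split=> //; constructor.
- exact: relocate_set_reg (EConst _ _ _ _ _) _ rel.
- by apply: relocate_set_reg (EAdd _ _ _ _ _ _) _ rel; rewrite !r1.
- by apply: relocate_set_reg (ESub _ _ _ _ _ _) _ rel; rewrite !r1.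
- by apply: relocate_set_reg (EGet _ _ _ _ _ _) _ rel; rewrite r1 r2.
- by apply: relocate_set_arr (EPut _ _ _ _ _ _) _ _ rel; rewrite r1.
- by apply: relocate_set_reg (ECoin _ _ _ _ _) _ rel; rewrite r1.
- by apply: relocate_set_reg (ENbr _ _ _ _ _ _) _ rel; rewrite !r1.
- have [Sa [ea ra la]] := IH1 _ rel; have [Sb [eb rb lb]] := IH2 _ ra.
  exists Sb; split=> //; [exact: ESeq ea eb|exact: same_low_trans la lb].
- have [Sa [ea ra la]] := IH _ rel.
  by exists Sa; split=> //; apply: EIfT; rewrite ?r1.
- have [Sa [ea ra la]] := IH _ rel.
  by exists Sa; split=> //; apply: EIfF; rewrite ?r1.
- have [Sa [ea ra la]] := IH1 _ rel; have [Sb [eb rb lb]] := IH2 _ ra.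
  exists Sb; split=> //; [apply: EWhileT ea eb|exact: same_low_trans la lb].
  by rewrite r1.
- by exists S; split=> //; apply: EWhileF; rewrite r1.
Qed.

Fixpoint writes_low (c : prog) : bool :=
  match c with
  | Skip => true
  | Const x _ | Add x _ _ | Defs.Sub x _ _ | Get x _ _ | Coin x _ | Nbr x _ _ => x < dr
  | Put A _ _ => A < da
  | Seq c1 c2 | If _ c1 c2 => writes_low c1 && writes_low c2
  | While _ c1 => writes_low c1
  end.

(** The opposite frame property: the search leaves the oracle's memory intact for the next
    invocation. *)
Lemma exec_same_high nbr tape c s s' q t :
  writes_low c -> exec nbr tape c s s' q t -> same_high s s'.
Proof.
move=> wl e; elim: e wl => {c s s' q t}
  [s|x a s|x y z s|x y z s|x A y s|A x y s|x y s|x y z s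
  |c1 c2 s sa sb qa qb ta tb _ IH1 _ IH2
  |x c1 c2 s sa qa ta nz _ IH|x c1 c2 s sa qa ta z _ IH
  |x c s sa sb qa qb ta tb nz _ IH1 _ IH2|x c s z] //=;
  try by move=> lt_x; split=> //= w; case: eqP => // ?; lia.
- by case/andP=> /IH1[a1 a2] /IH2[b1 b2]; split=> *; rewrite ?b1 ?b2 ?a1 ?a2.
- by case/andP=> /IH.
- by case/andP=> _ /IH.
- by move=> wl; case: (IH1 wl) (IH2 wl) => [a1 a2] [b1 b2]; split=> *;
    rewrite ?b1 ?b2 ?a1 ?a2.
Qed.

End Relocation.

(** * Incidence queries and the canonical tree of a part *)

Lemma uniq_unzip1_inj (A B : eqType) (s : seq (A * B)) a b b' :
  uniq (unzip1 s) -> (a, b) \in s -> (a, b') \in s -> b = b'.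
Proof.
elim: s => //= p s IH /andP[p_new us]; rewrite !inE.
case/predU1P=> [def_p|ab] /predU1P[def_p'|ab'].
- by move: def_p'; rewrite -def_p => -[].
- by case/negP: p_new; rewrite -def_p; apply: (map_f fst ab').
- by case/negP: p_new; rewrite -def_p'; apply: (map_f fst ab).
- exact: IH.
Qed.

Lemma neighbor_vid (G : graph) (ac : access G) (x : G) j :
  neighbor ac (vid ac x) j =
  if j < size (inc ac x) then (vid ac (nth x (inc ac x) j)).+1 else 0.
Proof.
rewrite /neighbor; case: pickP => [y /eqP/vid_inj -> //|/(_ x)].
by rewrite eqxx.
Qed.

Lemma size_inc_le (G : graph) (ac : access G) d (x : G) :
  degree_le d G -> size (inc ac x) <= d.
Proof.
move=> /(_ x); apply: leq_trans; rewrite -(card_uniqP (inc_uniq ac x)).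
by apply: subset_leq_card; apply/fintype.subsetP => y; rewrite mem_inc.
Qed.

(** Oriented: [w] is the parent of [u] in the tree rooted at the vertex of least id. *)
Definition tree_edge (G : graph) (ac : access G) (S : {set G}) (u w : G) : bool :=
  [exists r in S, [forall x in S, vid ac r <= vid ac x] &&
                  ((u, w) \in traverse ac S r #|S|)].

Lemma tree_edge_root (G : graph) (ac : access G) (S : {set G}) r u w :
  r \in S -> {in S, forall x, vid ac r <= vid ac x} ->
  tree_edge ac S u w = ((u, w) \in traverse ac S r #|S|).
Proof.
move=> rS rmin; apply/idP/idP => [/existsP[r' /and3P[r'S r'min]]|uw].
  suff -> : r' = r by [].
  apply: (@vid_inj _ ac); apply/eqP; rewrite eqn_leq rmin // andbT.
  by move/forall_inP: r'min; apply.
by apply/existsP; exists r; rewrite rS uw andbT; apply/forall_inP.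
Qed.

(* The program *)
Local Infix ";;" := Seq (at level 61, right associativity).

(* On entry [r_ans] holds the number of vertices. *)
Local Notation r_ans := 0 (only parsing).
Local Notation r_u := 1 (only parsing).
Local Notation r_v := 2 (only parsing).
Local Notation r_zero := 3 (only parsing).
Local Notation r_one := 4 (only parsing).
Local Notation r_epoch := 5 (only parsing).
Local Notation r_len := 6 (only parsing).
Local Notation r_cur := 7 (only parsing).
Local Notation r_root := 8 (only parsing).
Local Notation r_tmp := 9 (only parsing).
Local Notation r_head := 10 (only parsing).
Local Notation r_tail := 11 (only parsing).
Local Notation r_more := 12 (only parsing).
Local Notation r_pos := 13 (only parsing).
Local Notation r_nbr := 14 (only parsing).
Local Notation r_new := 15 (only parsing).
Local Notation r_oracle := 16 (only parsing).
Local Notation a_mark := 0 (only parsing).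
Local Notation a_parent := 1 (only parsing).
Local Notation a_queue := 2 (only parsing).
Local Notation a_oracle := 3 (only parsing).

(** Adding [r_zero] serves as a register copy. The oracle's input, the number of vertices and [u],
    goes to its shifted registers 0 and 1. *)
Definition call_setup : prog :=
  Const r_zero 0 ;; Const r_one 1 ;;
  Add r_oracle r_ans r_zero ;; Add (r_oracle + 1) r_u r_zero.

Definition mark_setup : prog :=
  Add r_epoch r_epoch r_one ;; Add r_len r_oracle r_zero ;;
  Add r_root r_u r_zero.

(** The oracle's list is read backwards, so that [r_len] is both counter and index. Truncated
    subtraction makes [r_tmp] nonzero iff [r_cur] is below the current candidate for the root. *)
Definition mark_body : prog :=
  Defs.Sub r_len r_len r_one ;; Get r_cur a_oracle r_len ;;
  Put a_mark r_cur r_epoch ;;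
  Defs.Sub r_tmp r_root r_cur ;; If r_tmp (Add r_root r_cur r_zero) Skip.

Definition search_setup : prog :=
  Put a_mark r_root r_zero ;; Put a_parent r_root r_root ;;
  Const r_head 0 ;; Put a_queue r_head r_root ;; Const r_tail 1 ;;
  Defs.Sub r_more r_tail r_head.

(** Query answers are ids plus 1, and the answer 0 past the end of the list stops the scan, so the
    program needs no knowledge of [d]. Writing mark 0 records a vertex as reached, since epochs are
    positive. *)
Definition visit_code : prog :=
  Defs.Sub r_new r_nbr r_one ;;
  Get r_tmp a_mark r_new ;; Defs.Sub r_tmp r_epoch r_tmp ;;
  If r_tmp Skip
    (Put a_mark r_new r_zero ;; Put a_parent r_new r_cur ;;
     Put a_queue r_tail r_new ;; Add r_tail r_tail r_one) ;;
  Add r_pos r_pos r_one ;; Nbr r_nbr r_cur r_pos.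

Definition scan_setup : prog :=
  Get r_cur a_queue r_head ;; Const r_pos 0 ;; Nbr r_nbr r_cur r_pos.

Definition scan_next : prog :=
  Add r_head r_head r_one ;; Defs.Sub r_more r_tail r_head.

Definition search_body : prog :=
  scan_setup ;; While r_nbr visit_code ;; scan_next.

(** With truncated subtraction, [(a - b) + (b - a)] is 0 iff [a = b]; this compares the parent of
    [u] with [v], then the parent of [v] with [u]. *)
Definition answer : prog :=
  Const r_ans 1 ;;
  Get r_tmp a_parent r_u ;; Defs.Sub r_new r_tmp r_v ;;
  Defs.Sub r_tmp r_v r_tmp ;; Add r_tmp r_tmp r_new ;;
  If r_tmp
    (Get r_tmp a_parent r_v ;; Defs.Sub r_new r_tmp r_u ;;
     Defs.Sub r_tmp r_u r_tmp ;; Add r_tmp r_tmp r_new ;;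
     If r_tmp (Const r_ans 0) Skip)
    Skip.

(* Marks never exceed the epoch, so a zero difference means equality. *)
Definition test_cut : prog :=
  Get r_tmp a_mark r_v ;; Defs.Sub r_tmp r_epoch r_tmp.

Definition decide : prog :=
  mark_setup ;; While r_len mark_body ;; test_cut ;;
  If r_tmp (Const r_ans 1)
    (search_setup ;; While r_more search_body ;; answer).

Definition spanner (O : prog) : prog :=
  call_setup ;; relocate r_oracle a_oracle O ;; decide.

(** * Correctness and cost of the decision procedure *)

Section Decide.
Variables (G : graph) (ac : access G) (tape : nat -> bool).
Variables (S : {set G}) (u v : G) (T : nat).
Notation runs := (runs (neighbor ac) tape).
Notation result := (result (neighbor ac) tape).
Notation id := (vid ac).

Definition in_query (s : store) : Prop :=
  [/\ reg s r_u = id u, reg s r_v = id v, reg s r_zero = 0,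
      reg s r_one = 1 & reg s r_epoch = T].

Definition stamped (A : pred G) (s : store) : Prop :=
  (forall i, arr s a_mark i <= T) /\
  (forall w, (arr s a_mark (id w) == T) = A w).

(** After [i] rounds the last [i] entries of [l] are treated. The root candidate always lies in [S],
    starting from [u]. *)
Definition marking (l : seq nat) (i : nat) (s : store) : Prop :=
  [/\ in_query s, reg s r_len = size l - i,
      forall j, j < size l -> arr s a_oracle j = nth 0 l j,
      stamped (fun w => id w \in drop (size l - i) l) s
    & exists2 r, r \in S & reg s r_root = id r /\
        {in drop (size l - i) l, forall a, id r <= a}].

Lemma runs_mark_body l i s :
  {in l, forall a, exists2 w, w \in S & a = id w} ->
  i < size l -> marking l i s ->
  reg s r_len != 0 /\
  runs mark_body s (prog_size mark_body) (prog_size mark_body) (marking l i.+1).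
Proof.
move=> lS lt_i [[e1 e2 e3 e4 e5] len_s list_s [le_T eqT] [r rS [root_s rmin]]].
have lt_n : size l - i.+1 < size l by lia.
have def_n : size l - i = (size l - i.+1).+1 by lia.
have def_drop : drop (size l - i.+1) l =
    nth 0 l (size l - i.+1) :: drop (size l - i) l.
  by rewrite def_n; apply: drop_nth.
split; first by rewrite len_s -lt0n subn_gt0.
apply: runs_loop_free => //=.
have -> : reg s 6 - reg s 4 = size l - i.+1 by rewrite len_s e4 def_n subn1.
rewrite list_s // e5 root_s.
have nth_l : nth 0 l (size l - i.+1) \in l by apply: mem_nth.
have [x xS def_x] := lS _ nth_l.
rewrite /marking def_drop def_x.
have stmp s' : (forall j, arr s' 0 j = if j == id x then T else arr s 0 j) ->
    stamped (fun w => id w \in id x :: drop (size l - i) l) s'.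
  move=> eq_s'; split=> [j|w]; rewrite eq_s'; first by case: eqP.
  by rewrite inE; case: (id w =P id x) => _; rewrite ?eqxx ?eqT.
case: eqP => [le_rx|gt_rx]; split=> //=; try by apply: stmp.
- exists r => //; split=> // a; rewrite inE => /predU1P[->|/rmin //]; lia.
- exists x => //; split=> [|a]; first by rewrite e3 addn0.
  rewrite inE => /predU1P[->|/rmin] //; lia.
Qed.

Definition searching (r : G) (vis : seq (G * G)) (s : store) : Prop :=
  [/\ stamped (fun w => (w \in S) && (w \notin unzip1 vis)) s,
      forall i, i < size vis -> arr s a_queue i = id (nth (r, r) vis i).1,
      {in vis, forall p, arr s a_parent (id p.1) = id p.2}
    & reg s r_tail = size vis].

(** Neighbors before position [j] are treated, and the answer for position [j] is already fetched,
    as the loop test needs it. *)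
Definition scanning (r x : G) (vis : seq (G * G)) (h j : nat) (s : store) : Prop :=
  [/\ in_query s, searching r (foldl (visit S x) vis (take j (inc ac x))) s,
      reg s r_cur = id x, reg s r_head = h
    & reg s r_pos = j /\ reg s r_nbr = neighbor ac (id x) j].

Hypothesis T_gt0 : 0 < T.

Lemma runs_visit_code r x vis h j s :
  j < size (inc ac x) -> scanning r x vis h j s ->
  reg s r_nbr != 0 /\
  runs visit_code s (prog_size visit_code) (prog_size visit_code)
    (scanning r x vis h j.+1).
Proof.
move=> lt_j [[e1 e2 e3 e4 e5] [[le_T eqT] queue_s par_s tail_s] cur_s head_s].
rewrite neighbor_vid lt_j => -[pos_s nbr_s].
set y := nth x (inc ac x) j in nbr_s.
split; first by rewrite nbr_s.
apply: runs_loop_free => //=.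
rewrite /scanning (take_nth x lt_j) -cats1 foldl_cat /= -/y.
move: (foldl _ _ _) eqT queue_s par_s tail_s => V eqT queue_s par_s tail_s.
have -> : reg s 14 - reg s 4 = id y by lia.
rewrite subn_eq0 e5.
(* The machine test becomes the guard of [visit]. *)
have -> : (T <= arr s 0 (id y)) = (y \in S) && (y \notin unzip1 V).
  by rewrite -eqT eqn_leq le_T.
rewrite /visit; case: ifP => [/andP[yS y_new]|_]; last first.
  split=> //=; split; by rewrite ?pos_s ?e4 ?addn1 ?cur_s.
split=> //=; last by split; rewrite ?pos_s ?e4 ?addn1 ?cur_s.
split=> /=.
- split=> [i|w] /=; first by case: eqP => // _; rewrite e3.
  rewrite /unzip1 map_rcons mem_rcons inE (inj_eq (@vid_inj _ ac)).
  case: (w =P y) => [->|/eqP yw]; first by rewrite e3 andbF; apply/eqP; lia.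
  by rewrite eqT.
- move=> i; rewrite size_rcons ltnS leq_eqVlt nth_rcons tail_s.
  case/predU1P=> [->|lt_i]; first by rewrite eqxx ltnn.
  by rewrite lt_i (ltn_eqF lt_i) queue_s.
- move=> p; rewrite mem_rcons inE => /predU1P[->|pV] /=; first by rewrite eqxx.
  rewrite (inj_eq (@vid_inj _ ac)); case: eqP => [def_p|_]; last exact: par_s.
  by case/negP: y_new; rewrite -def_p; apply: (map_f fst pV).
- by rewrite size_rcons tail_s e4 addn1.
Qed.

Definition search_at (r : G) (h : nat) (s : store) : Prop :=
  [/\ in_query s, searching r (traverse ac S r h) s, reg s r_head = h
    & reg s r_more = size (traverse ac S r h) - h].

Definition search_cost (d : nat) : nat :=
  prog_size scan_setup + ((d * (prog_size visit_code).+1).+1 + prog_size scan_next).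

(** By [traverse_progress] the queue stays nonempty for [#|S|] rounds; each round scans one
    incidence list, of length at most [d]. *)
Lemma runs_search_body d r h s :
  degree_le d G -> r \in S -> induces_connected S ->
  h < #|S| -> search_at r h s ->
  reg s r_more != 0 /\
  runs search_body s (search_cost d) (search_cost d) (search_at r h.+1).
Proof.
move=> deg rS conn lt_h [[e1 e2 e3 e4 e5] srch head_s more_s].
have lt_size := traverse_progress ac rS conn lt_h.
split; first by rewrite more_s -lt0n subn_gt0.
apply: runs_seq; apply: runs_loop_free => //=.
have [stmp queue_s par_s tail_s] := srch.
rewrite head_s queue_s //; set x := (nth _ _ _).1.
set s1 := set_reg 14 _ _.
have scan0 : scanning r x (traverse ac S r h) h 0 s1 by rewrite /scanning take0.
have deg_x := size_inc_le ac x deg.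
apply: runs_seq.
apply: runs_weaken (runs_while (fun i s2 lt_i => runs_visit_code lt_i) _ scan0).
- exact: leqW (leq_mul deg_x (leqnSn _)).
- by rewrite ltnS leq_mul.
- move=> s2 [[f1 f2 f3 f4 f5]]; rewrite take_size => srch2 _ head2 _.
  have [stmp2 queue2 par2 tail2] := srch2.
  apply: runs_loop_free => //; rewrite /= head2 f4 addn1.
  by split=> //=; rewrite tail2.
- by move=> s2 [_ _ _ _ [_ ->]]; rewrite neighbor_vid ltnn.
Qed.

Definition decision : bool :=
  [|| v \notin S, tree_edge ac S u v | tree_edge ac S v u].

(** The bound on the marks is what the next invocation relies on. *)
Definition decided (s : store) : Prop :=
  (forall i, arr s a_mark i <= reg s r_epoch) /\ output_bool s = decision.

Lemma runs_answer r s :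
  r \in S -> {in S, forall x, id r <= id x} -> induces_connected S ->
  u \in S -> v \in S -> search_at r #|S| s ->
  runs answer s (prog_size answer) (prog_size answer) decided.
Proof.
move=> rS rmin conn uS vS [[e1 e2 e3 e4 e5] [[le_T eqT] _ par_s _] _ _].
apply: runs_loop_free => //=.
have [uvis _ _ _ _] := search_tree_traverse ac rS #|S|.
(* The finished search has reached all of [S], each vertex with one parent, so the parent cells
   decide tree edges. *)
have parE a b : a \in S -> (arr s 1 (id a) == id b) = tree_edge ac S a b.
  move=> aS; rewrite (tree_edge_root _ _ rS rmin).
  move: aS; rewrite -(mem_traverse ac rS conn) => /mapP[[a' w] aw /= def_a].
  rewrite -{}def_a in aw; rewrite (par_s _ aw) /= (inj_eq (@vid_inj _ ac)).
  apply/eqP/idP => [<- //|]; exact: uniq_unzip1_inj aw.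
rewrite /decided /output_bool /decision vS -!parE //= e1 e2.
have eqE a b : (b - a + (a - b) == 0) = (a == b) by lia.
rewrite eqE; case: eqP => _ /=; first by rewrite e5.
by rewrite eqE; case: eqP => _ /=; rewrite e5.
Qed.

Definition decide_cost (k d : nat) : nat :=
  prog_size mark_setup + ((k * (prog_size mark_body).+1).+1 +
   (prog_size test_cut + (prog_size search_setup +
      ((k * (search_cost d).+1).+1 + prog_size answer)).+1)).

End Decide.

Lemma runs_decide (G : graph) (ac : access G) tape (S : {set G}) (u v : G)
    T k d l s :
  in_query ac u v T s -> (forall i, arr s a_mark i <= T) ->
  reg s r_oracle = size l ->
  (forall j, j < size l -> arr s a_oracle j = nth 0 l j) ->
  perm_eq l [seq vid ac w | w <- enum S] ->
  u \in S -> #|S| <= k -> degree_le d G -> induces_connected S ->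
  runs (neighbor ac) tape decide s (decide_cost k d) (decide_cost k d)
    (decided ac S u v).
Proof.
move=> [e1 e2 e3 e4 e5] le_T len_l list_l perm_l uS card_S deg conn.
have T_gt0 : 0 < T.+1 by [].
have lS : {in l, forall a, exists2 w, w \in S & a = vid ac w}.
  move=> a; rewrite (perm_mem perm_l) => /mapP[w]; rewrite mem_enum => wS ->.
  by exists w.
have mem_l w : (vid ac w \in l) = (w \in S).
  by rewrite (perm_mem perm_l) (mem_map (@vid_inj _ ac)) mem_enum.
have size_l : size l = #|S| by rewrite (perm_size perm_l) size_map -cardE.
apply: runs_seq; apply: runs_loop_free => //=.
set s1 := set_reg 8 _ _.
have mark0 : marking ac S u v T.+1 l 0 s1.
  rewrite /s1; split=> //=.
  - by split=> //=; rewrite e4 e5 addn1.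
  - by rewrite len_l e3 addn0 subn0.
  (* The new epoch exceeds every old mark, so no vertex is stamped yet. *)
  - split=> [i|w] /=; first by rewrite (leq_trans (le_T i)).
    rewrite subn0 drop_size; apply/negbTE; rewrite neq_ltn ltnS le_T //.
  - by exists u => //; rewrite e1 e3 addn0 subn0 drop_size.
apply: runs_seq.
have body i s2 : i < size l -> marking ac S u v T.+1 l i s2 -> _ :=
  @runs_mark_body _ _ tape _ _ _ _ l i s2 lS.
refine (runs_weaken _ _ _ (runs_while body _ mark0)).
- by rewrite size_l; apply: leqW (leq_mul card_S (leqnSn _)).
- by rewrite ltnS leq_mul // size_l.
- move=> s2 [[f1 f2 f3 f4 f5] _ _]; rewrite subnn drop0 => stmp [r rS [root2 rmin]].
  have [le2 eq2] := stmp.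
  apply: runs_seq; apply: runs_loop_free => //=.
  rewrite f2 f5; set s3 := set_reg _ _ _.
  have tmp3 : (reg s3 r_tmp == 0) = (v \in S).
    by rewrite /= subn_eq0 -mem_l -eq2 eqn_leq le2.
  apply: runs_weaken (leqnSn _) (leqnn _) (fun _ h => h) _.
  apply: runs_if; rewrite tmp3; case: ifPn => vS; last first.
    refine (runs_weaken _ _ (fun _ h => h)
      (runs_loop_free (c := Const r_ans 1) isT _)) => //.
    by split=> [i|] /=; rewrite ?f5 // /output_bool /decision /= vS.
  apply: runs_seq; apply: runs_loop_free => //=.
  rewrite root2 f3; set s4 := set_reg 12 _ _.
  have rmin' : {in S, forall x, vid ac r <= vid ac x}.
    by move=> x; rewrite -mem_l => /rmin.
  have search0 : search_at ac S u v T.+1 r 0 s4.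
    rewrite /s4; split=> //=; split=> //=.
    - split=> [i|w] /=; first by case: eqP.
      rewrite (inj_eq (@vid_inj _ ac)) inE.
      by case: (w =P r) => [->|_]; rewrite ?andbF // eq2 mem_l andbT.
    - by case.
    - by move=> p; rewrite inE => /eqP ->; rewrite eqxx.
  apply: runs_seq.
  have search_step h s5 : h < #|S| -> search_at ac S u v T.+1 r h s5 -> _ :=
    @runs_search_body _ _ tape _ _ _ _ T_gt0 d r h s5 deg rS conn.
  refine (runs_weaken _ _ _ (runs_while search_step _ search0)).
  - exact: leqW (leq_mul card_S (leqnSn _)).
  - by rewrite ltnS leq_mul.
  - by move=> s5; apply: runs_answer.
  - by move=> s5 [_ _ _ ->]; rewrite size_traverse // subnn.
- by move=> s2 [_ ->]; rewrite subnn.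
Qed.

(** * The spanning subgraph: size and connectivity *)

Section Spanning.
Variables (G : graph) (ac : access G) (P : {set {set G}}).
Hypothesis partP : finset.partition P [set: G]%SET.
Notation part := (finset.pblock P).

Lemma mem_part (x : G) : x \in part x.
Proof. by rewrite finset.mem_pblock (finset.cover_partition partP) finset.in_setT. Qed.

Lemma part_mem (x : G) : part x \in P.
Proof. by rewrite finset.pblock_mem // (finset.cover_partition partP) finset.in_setT. Qed.

Lemma part_eq (x y : G) : (part x == part y) = (y \in part x).
Proof.
rewrite finset.eq_pblock ?(finset.cover_partition partP) ?finset.in_setT //.
exact: finset.partition_trivIset partP.
Qed.

Definition spanning_edges : {set {set G}} :=
  [set [set uv.1; uv.2] | uv : G * G
     & adj uv.1 uv.2 && decision ac (part uv.1) uv.1 uv.2]%SET.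

(** Makes the answer a property of the unordered edge, although only the part of the first endpoint
    is requested. *)
Lemma decision_sym (x y : G) : decision ac (part x) x y = decision ac (part y) y x.
Proof.
rewrite /decision -!part_eq eq_sym; case: eqP => //= ->.
by rewrite orbC.
Qed.

Lemma mem_spanning_edges (u v : G) : adj u v ->
  ([set u; v]%SET \in spanning_edges) = decision ac (part u) u v.
Proof.
move=> uv; apply/idP/idP => [/imsetP[[x y]]|dec]; last first.
  by apply/imsetP; exists (u, v); rewrite // inE /= uv.
rewrite inE /= => /andP[xy dec] eq_uv.
have u_xy : u \in [set x; y]%SET by rewrite -eq_uv finset.set21.
have v_xy : v \in [set x; y]%SET by rewrite -eq_uv finset.set22.
have x_uv : x \in [set u; v]%SET by rewrite eq_uv finset.set21.
case/finset.set2P: u_xy v_xy x_uv uv => -> /finset.set2P[] -> //.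
- by rewrite adj_irr.
- by rewrite decision_sym.
- by rewrite adj_irr.
Qed.

Lemma spanning_edges_sub : spanning_edges \subset edges G.
Proof.
apply/fintype.subsetP => e /imsetP[uv]; rewrite inE => /andP[adj_uv _] ->.
by apply: imset_f; rewrite inE.
Qed.

Lemma tree_edge_parent_uniq (S : {set G}) (x y z : G) :
  tree_edge ac S x y -> tree_edge ac S x z -> y = z.
Proof.
move=> /existsP[r /and3P[rS /forall_inP rmin xy]].
rewrite (tree_edge_root _ _ rS rmin) => xz.
have [uvis _ _ _ _] := search_tree_traverse ac rS #|S|.
exact: uniq_unzip1_inj xy xz.
Qed.

Lemma card_spanning_edges : #|spanning_edges| <= #|cut_edges P| + #|G|.
Proof.
(* The default [w] makes this total; [forest] is then an image of the vertex set, hence has at most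
   [#|G|] elements. *)
pose parent w := odflt w [pick z | tree_edge ac (part w) w z].
have parentP w z : tree_edge ac (part w) w z -> parent w = z.
  rewrite /parent; case: pickP => [z' /= wz'|/(_ z) ->] // wz.
  exact: tree_edge_parent_uniq wz' wz.
pose forest := [set [set w; parent w]%SET | w : G]%SET.
have sub : spanning_edges \subset cut_edges P :|: forest.
  apply/fintype.subsetP => e /imsetP[[x y]]; rewrite !inE /= => /andP[xy dec] ->.
  apply/orP; move: dec; rewrite /decision -part_eq.
  case: eqP => [eq_xy|/eqP neq_xy] /=; last first.
    by move=> _; left; apply/imsetP; exists (x, y); rewrite // inE /= xy.
  case/orP=> [/parentP <-|]; first by right; apply/imsetP; exists x.
  rewrite eq_xy => /parentP <-; rewrite finset.setUC.
  by right; apply/imsetP; exists y.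
apply: leq_trans (subset_leq_card sub) _.
apply: leq_trans (finset.leq_card_setU _ _) _.
by rewrite leq_add2l; apply: leq_imset_card.
Qed.

Lemma connected_spanning_edges :
  connected_graph G -> {in P, forall S, induces_connected S} ->
  connected_edges spanning_edges.
Proof.
move=> connG connP x y; move: (connG x y); apply: connect_sub => {}x {}y xy.
have [eq_xy|neq_xy] := eqVneq (part x) (part y); last first.
  apply: connect1; rewrite /= mem_spanning_edges //.
  by rewrite /decision -part_eq neq_xy.
set E := [rel a b | _]; pose S := part x.
have symE : connect_sym E.
  by apply: sym_connect_sym => a b; rewrite /= finset.setUC.
have [r rS rmin] := arg_minnP (vid ac) (mem_part x : x \in S).
have conn_r z : z \in S -> connect E r z.
  have connS := connP _ (part_mem x).
  have [_ sub _ conn adjP] := search_tree_traverse ac rS #|S|.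
  rewrite -(mem_traverse ac rS connS) => /conn; apply: connect_sub => a b /= ba.
  (* The root's pair with itself gives the empty path. *)
  have [/= -> //|/= adj_ba] := adjP _ ba.
  have bS : b \in S by apply: sub; apply: (map_f fst ba).
  apply: connect1; rewrite /= finset.setUC mem_spanning_edges // /decision.
  have -> : part b = S by apply/esym/eqP; rewrite part_eq.
  by rewrite (tree_edge_root _ _ rS rmin) ba orbT.
have yS : y \in S by rewrite -part_eq eq_xy.
apply: connect_trans (conn_r _ yS); rewrite symE; exact: conn_r (mem_part x).
Qed.

End Spanning.

(** Parts are nonempty, so each one is the block of some vertex. *)
Lemma partition_ext (G : graph) (P Q : {set {set G}}) :
  finset.partition P [set: G]%SET -> finset.partition Q [set: G]%SET ->
  finset.pblock P =1 finset.pblock Q -> P = Q.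
Proof.
move=> partP partQ eqPQ; apply/eqP; rewrite finset.eqEsubset.
have sub (A B : {set {set G}}) : finset.partition A [set: G]%SET ->
    finset.partition B [set: G]%SET -> finset.pblock A =1 finset.pblock B ->
    A \subset B.
  move=> partA partB eqAB; apply/fintype.subsetP => S SA.
  have [x xS] := finset.set0Pn _ (finset.partition_neq0 partA SA).
  rewrite -(finset.def_pblock (finset.partition_trivIset partA) SA xS) eqAB.
  exact: part_mem.
by rewrite !sub // => x; rewrite eqPQ.
Qed.

(** * One invocation of the combined algorithm *)

Definition spanner_invariant (G : graph) (ac : access G) tape (O : prog)
    (s : store) : Prop :=
  exists2 so, reachable (neighbor ac) tape (vertex_query ac) O so &
    relocated r_oracle a_oracle so s /\
    (forall i, arr s a_mark i <= reg s r_epoch).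

(** The left side evaluates to [12 * k * d + 15 * k + 32]; by positivity [k * d] absorbs the lower
    terms, and 100 is a round bound. *)
Lemma spanner_overhead k d : 0 < k -> 0 < d ->
  prog_size call_setup + decide_cost k d <= 100 * (k * d).
Proof.
move=> k_gt0 d_gt0; rewrite /decide_cost /search_cost /=.
have: k <= k * d by rewrite leq_pmulr.
have: 1 <= k * d by rewrite muln_gt0 k_gt0.
nia.
Qed.

(** The oracle's guarantee covers only memories reachable by vertex queries. Hence a genuine oracle
    memory [so] is tracked, whose shifted copy sits in [s]; the call advances it by the query
    [u]. *)
Lemma runs_spanner (G : graph) (ac : access G) tape O (S : {set G}) (u v : G)
    k d so so' s q t :
  reachable (neighbor ac) tape (vertex_query ac) O so ->
  relocated r_oracle a_oracle so s ->
  (forall i, arr s a_mark i <= reg s r_epoch) ->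
  exec (neighbor ac) tape O (load [:: #|G|; vid ac u] so) so' q t ->
  perm_eq (output_list so') [seq vid ac w | w <- enum S] ->
  u \in S -> #|S| <= k -> degree_le d G -> induces_connected S -> adj u v ->
  runs (neighbor ac) tape (spanner O)
    (load [:: #|G|; vid ac u; vid ac v] s)
    (q + 100 * (k * d)) (t + 100 * (k * d))
    (fun s' => spanner_invariant ac tape O s' /\ output_bool s' = decision ac S u v).
Proof.
move=> reach_so [rel_reg rel_arr] le_epoch exec_O perm_out uS card_S deg conn uv.
(* The queried edge forces [k] and [d] to be positive, so no separate additive constant is left. *)
have k_gt0 : 0 < k by apply: leq_trans card_S; apply/card_gt0P; exists u.
have d_gt0 : 0 < d by apply: leq_trans (deg u); apply/card_gt0P; exists v.
have overhead := spanner_overhead k_gt0 d_gt0.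
apply: (@runs_weaken _ _ _ _ (prog_size call_setup + (q + decide_cost k d))
  (prog_size call_setup + (t + decide_cost k d))); [lia|lia|by move=> ?; exact|].
apply: runs_seq; apply: runs_loop_free => //.
set s1 := result _ _ _ _.
have rel1 : relocated r_oracle a_oracle (load [:: #|G|; vid ac u] so) s1.
  by split=> [[|[|x]]|A i] /=; rewrite ?addn0 // -?rel_arr // -rel_reg.
have [s2 [exec2 [rel2_reg rel2_arr] [low_reg low_arr]]] := exec_relocate exec_O rel1.
apply: runs_seq; exists s2, q, t; split=> //.
have query2 : in_query ac u v (reg s2 r_epoch) s2 by split; rewrite ?low_reg.
have mark2 i : arr s2 a_mark i <= reg s2 r_epoch.
  by rewrite low_arr // low_reg //; exact: le_epoch.
have len2 : reg s2 r_oracle = size (output_list so').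
  by rewrite size_map size_iota -rel2_reg.
have list2 j : j < size (output_list so') ->
    arr s2 a_oracle j = nth 0 (output_list so') j.
  rewrite size_map size_iota => lt_j.
  by rewrite (nth_map 0) ?size_iota // nth_iota // add0n -rel2_arr.
have [s3 [q3 [t3 [exec3 le_q le_t [dec_le dec_out]]]]] :=
  runs_decide tape query2 mark2 len2 list2 perm_out uS card_S deg conn.
exists s3, q3, t3; split=> //; split=> //.
exists so'; first exact: ReachStep reach_so (ex_intro _ u erefl) exec_O.
split=> //; apply: relocated_high (exec_same_high _ exec3); by [split|].
Qed.

(** * Measurability of events read off the coins *)

Section CoinEvents.
Local Open Scope classical_set_scope.
Variables (disp : measure_display) (Omega : measurableType disp).
Variable coin : Omega -> nat -> bool.
Hypothesis measurable_coin : forall i, measurable [set w | coin w i].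

Lemma measurable_coin_eq i b : measurable [set w | coin w i = b].
Proof.
case: b; first exact: measurable_coin.
have -> : [set w | coin w i = false] = ~` [set w | coin w i].
  by apply/seteqP; split=> w /=; [move=> ->|move/negP/negbTE].
exact: measurableC.
Qed.

(* A function of the tape that only reads a finite prefix of it has countable
   unions of cylinders as fibers. *)
Lemma measurable_finitely_read (A : Type) (f : (nat -> bool) -> A) (B : set A) :
  (forall tape, exists N, forall tape',
     (forall i, (i < N)%N -> tape i = tape' i) -> f tape = f tape') ->
  measurable [set w | B (f (coin w))].
Proof.
move=> f_local.
pose agrees (b : seq bool) (tape : nat -> bool) :=
  forall i, (i < size b)%N -> tape i = nth false b i.
pose good b := forall tape, agrees b tape -> B (f tape).
(* Finite bit sequences are countable, and the good ones index cylinders that cover the event. *)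
pose F b := if `[< good b >] then [set w | agrees b (coin w)] else set0.
have -> : [set w | B (f (coin w))] = \bigcup_b F b.
  apply/seteqP; split=> [w /= Bw|w [b _]]; rewrite /F; last first.
    by case: asboolP => // good_b; apply: good_b.
  have [N f_N] := f_local (coin w).
  exists (mkseq (coin w) N) => //; case: asboolP => [_ i|[tape agr]].
    by rewrite size_mkseq => lt_i; rewrite nth_mkseq.
  rewrite -f_N // => i lt_i; rewrite agr ?size_mkseq //.
  by rewrite nth_mkseq.
apply: countable_bigcupT_measurable => // b.
rewrite /F; case: asboolP => // _.
have -> : [set w | agrees b (coin w)] =
    \bigcap_(i in [set i | (i < size b)%N]) [set w | coin w i = nth false b i].
  by apply/seteqP; split=> w /= H i; apply: H.
by apply: bigcap_measurableType => i _; apply: measurable_coin_eq.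
Qed.

End CoinEvents.

(** One halting run per vertex from zeroed memory determines all blocks; the maximum of the prefixes
    read works for every vertex. *)
Lemma oracle_partition_local (G : graph) (ac : access G) (O : prog)
    (P : (nat -> bool) -> {set {set G}}) :
  (forall tape, finset.partition (P tape) [set: G]%SET) ->
  (forall tape s (v : G), reachable (neighbor ac) tape (vertex_query ac) O s ->
     exists s' q t,
       exec (neighbor ac) tape O (load [:: #|G|; vid ac v] s) s' q t /\
       perm_eq (output_list s')
               [seq vid ac w | w <- enum (finset.pblock (P tape) v)]) ->
  forall tape, exists N, forall tape',
    (forall i, i < N -> tape i = tape' i) -> P tape = P tape'.
Proof.
move=> partP queryP tape.
have [N N_P] : exists N : G -> nat, forall v tape',
    (forall i, i < N v -> tape i = tape' i) ->
    finset.pblock (P tape) v = finset.pblock (P tape') v.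
  pose reads v n := forall tape', (forall i, i < n -> tape i = tape' i) ->
    finset.pblock (P tape) v = finset.pblock (P tape') v.
  apply: (@fin_all_exists G (fun=> nat) reads) => v.
  have [s1 [q1 [t1 [exec1 out1]]]] := queryP tape store0 v (ReachInit _ _ _ _).
  have [N N_exec] := exec_tape_prefix exec1.
  exists N => tape' /N_exec exec1'.
  have [s2 [q2 [t2 [exec2 out2]]]] := queryP tape' store0 v (ReachInit _ _ _ _).
  have [eq_s _ _] := exec_det exec1' exec2.
  rewrite -eq_s in out2; apply/finset.setP => w.
  rewrite -!(mem_enum (finset.pblock _ _)) -!(mem_map (@vid_inj _ ac)).
  by rewrite -(perm_mem out1) -(perm_mem out2).
exists (\max_v N v) => tape' eq_tape; apply: partition_ext => // v.
by apply: N_P => i lt_i; apply: eq_tape; apply: leq_trans lt_i (leq_bigmax v).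
Qed.

(** * Arbitrary query histories and the final reduction *)

Lemma runs_reachable_spanner (G : graph) (ac : access G) tape (O : prog)
    (P : {set {set G}}) k d qO tO :
  degree_le d G -> finset.partition P [set: G]%SET ->
  {in P, forall S : {set G}, #|S| <= k /\ induces_connected S} ->
  (forall s (v : G), reachable (neighbor ac) tape (vertex_query ac) O s ->
     runs (neighbor ac) tape O (load [:: #|G|; vid ac v] s) qO tO
       (fun s' => perm_eq (output_list s')
                    [seq vid ac w | w <- enum (finset.pblock P v)])) ->
  forall s (u v : G),
  reachable (neighbor ac) tape (edge_query ac) (spanner O) s -> adj u v ->
  runs (neighbor ac) tape (spanner O) (load [:: #|G|; vid ac u; vid ac v] s)
    (qO + 100 * (k * d)) (tO + 100 * (k * d))
    (fun s' => output_bool s' = ([set u; v]%SET \in spanning_edges ac P)).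
Proof.
move=> deg partP parts oracle.
have step s u v : spanner_invariant ac tape O s -> adj u v ->
    runs (neighbor ac) tape (spanner O) (load [:: #|G|; vid ac u; vid ac v] s)
      (qO + 100 * (k * d)) (tO + 100 * (k * d))
      (fun s' => spanner_invariant ac tape O s' /\
         output_bool s' = ([set u; v]%SET \in spanning_edges ac P)).
  move=> [so reach_so [rel_so le_epoch]] uv.
  have [so' [q' [t' [exec_O le_q le_t perm_out]]]] := oracle so u reach_so.
  have [card_S conn_S] := parts _ (part_mem partP u).
  rewrite mem_spanning_edges //.
  have := runs_spanner reach_so rel_so le_epoch exec_O perm_out
    (mem_part partP u) card_S deg conn_S uv.
  by apply: runs_weaken => //; rewrite leq_add2r.
have invariant s : reachable (neighbor ac) tape (edge_query ac) (spanner O) s ->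
    spanner_invariant ac tape O s.
  elim=> [|{}s s' xs q' t' _ IH [u [v [uv ->]]] exec_s].
    by exists store0; first exact: ReachInit.
  (* By determinism the run in the history is the one just analyzed. *)
  have [s'' [q'' [t'' [exec_s' _ _ [inv' _]]]]] := step s u v IH uv.
  by have [-> _ _] := exec_det exec_s exec_s'.
move=> s u v /invariant inv_s uv.
by apply: runs_weaken (step s u v inv_s uv) => // s' [].
Qed.

Theorem theorem7 :
  exists c : nat,
  forall (R : realType) (disp : measure_display) (Omega : measurableType disp)
    (Pr : probability Omega R) (coin : Omega -> nat -> bool),
  fair_coins Pr coin ->
  forall (C : graph -> Prop) (d : nat),
  (forall G : graph, C G -> degree_le d G) ->
  forall (eps : R) (k : nat) (p : R) (q t : R -> nat -> nat -> nat -> nat)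
    (O : prog),
  partition_oracle Pr coin C d eps k p O ->
  complexity_le C vertex_query O (q eps k d) (t eps k d) ->
  exists A : prog,
    sparse_spanning_algorithm Pr coin C eps p A /\
    complexity_le C edge_query A
      (fun n => q eps k d n + c * (k * d))%N
      (fun n => t eps k d n + c * (k * d))%N.
Proof.
exists 100 => R disp Omega Pr coin [meas_coin _] C d degC eps k p q t O oracle cost.
exists (spanner O).
have oracle_runs (G : graph) (ac : access G) (P : {set {set G}}) tape :
    C G ->
    (forall s (v : G), reachable (neighbor ac) tape (vertex_query ac) O s ->
       exists s' q' t',
         exec (neighbor ac) tape O (load [:: #|G|; vid ac v] s) s' q' t' /\
         perm_eq (output_list s')
                 [seq vid ac w | w <- enum (finset.pblock P v)]) ->
    forall s (v : G), reachable (neighbor ac) tape (vertex_query ac) O s ->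
    runs (neighbor ac) tape O (load [:: #|G|; vid ac v] s)
      (q eps k d #|G|) (t eps k d #|G|)
      (fun s' => perm_eq (output_list s')
                   [seq vid ac w | w <- enum (finset.pblock P v)]).
  move=> CG queryP s v reach_s.
  have [s1 [q1 [t1 [exec1 out1]]]] := queryP s v reach_s.
  have [s2 [q2 [t2 [exec2 le_q le_t]]]] :=
    cost G ac tape s _ CG reach_s (ex_intro _ v erefl).
  (* Correctness and cost each supply a run; determinism identifies them. *)
  have [eq_s _ _] := exec_det exec1 exec2; rewrite eq_s in out1.
  by exists s2, q2, t2.
split=> [G ac CG connG|G ac tape s xs CG reach_s [u [v [uv ->]]]].
  have [P [partP queryP parts prob]] := oracle G ac (degC G CG).
  have localP := oracle_partition_local partP queryP.
  exists (fun tape => spanning_edges ac (P tape)); split.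
  - by move=> tape; apply: spanning_edges_sub.
  - move=> tape s u v reach_s uv.
    have [s' [q' [t' [exec_s _ _ out]]]] := runs_reachable_spanner (degC G CG)
      (partP tape) (parts tape) (oracle_runs G ac _ tape CG (queryP tape)) reach_s uv.
    by exists s', q', t'.
  (* Connectivity holds for every tape, so the event is the whole space. *)
  - have -> : [set w | connected_edges (spanning_edges ac (P (coin w)))]%classic
        = [set: Omega]%classic.
      apply/seteqP; split=> w //= _; apply: connected_spanning_edges => //.
      by move=> S /parts[].
    exact: probability_setT.
  - apply: le_trans (prob CG) _; apply: le_measure.
    + apply: mem_set.
      exact: (measurable_finitely_read meas_coin
        [set Q | (#|cut_edges Q|%:R <= eps * #|G|%:R :> R)%R]%classic localP).
    + apply: mem_set.
      exact: (measurable_finitely_read meas_coin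
        [set Q | (#|spanning_edges ac Q|%:R <= (1 + eps) * #|G|%:R :> R)%R]%classic
        localP).
    (* Event inclusion: at most [eps * n] cut edges plus [n] parent edges. *)
    + move=> w /= cut_le.
      have := card_spanning_edges ac (partP (coin w)).
      rewrite -(ler_nat R) natrD => /le_trans; apply.
      by rewrite mulrDl mul1r addrC lerD2l.
have [P [partP queryP parts prob]] := oracle G ac (degC G CG).
have [s' [q' [t' [exec_s le_q le_t out]]]] := runs_reachable_spanner (degC G CG)
  (partP tape) (parts tape) (oracle_runs G ac _ tape CG (queryP tape)) reach_s uv.
by exists s', q', t'.
Qed.
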